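(* Let $n\ge3$. There exists an affine Osserman manifold $(M,D)$ of dimension $n$ such that, with $N=T^*M$, $g_N$ the modified Riemannian extension metric and $\mathfrak{J}$ the canonical almost para-Hermitian structure on $(N,g_N)$, the manifold $(N,g_N,\mathfrak{J})$ is not Jordan semi para-complex Osserman, and such that the para-complex Jacobi operators are not always diagonalizable (i.e. there is $\pi\in\mathcal{P}(N)$ for which ${}^{g_N}\mathcal{J}(\pi)$ is not diagonalizable).
   Context: An affine manifold $(M,D)$ is a smooth manifold $M$ with a torsion-free connection $D$ on $TM$. Curvature: ${}^DR(X,Y)=D_XD_Y-D_YD_X-D_{[X,Y]}$. Jacobi operator: ${}^D\mathcal{J}(X):Y\mapsto {}^DR(Y,X)X$. $(M,D)$ is affine Osserman if ${}^D\mathcal{J}(X)$ is nilpotent for every tangent vector $X$. For a pseudo-Riemannian metric $g$, ${}^gR$ (of the Levi-Civita connection) has the same sign convention and ${}^g\mathcal{J}(X):Y\mapsto {}^gR(Y,X)X$. Modified Riemannian extension: let $N=T^*M$, $n=\dim M$. Local coordinates $(x_1,\dots,x_n)$ on $M$ induce coordinates $(x_1,\dots,x_n,x_{1'},\dots,x_{n'})$ on $N$ by writing a 1-form as $\omega=x_{i'}dx^i$ (Einstein summation). Write $D_{\partial_{x_i}}\partial_{x_j}={}^D\Gamma_{ij}{}^k\partial_{x_k}$ and $u\circ v=\frac12(u\otimes v+v\otimes u)$. Then $g_N$ is the (globally well-defined) metric of neutral signature $(n,n)$ on $N$ given locally by $g_N=2\,dx^i\circ dx^{i'}+\{x_{i'}x_{j'}-2x_{k'}{}^D\Gamma_{ij}{}^k\}dx^i\circ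 dx^j$. The canonical almost para-Hermitian structure $\mathfrak{J}$ (an endomorphism of $TN$ with $\mathfrak{J}^2=\mathrm{Id}$ and $\mathfrak{J}^*g_N=-g_N$) is given locally by $\mathfrak{J}\partial_{x_i}=\partial_{x_i}-\{x_{i'}x_{j'}-2x_{k'}{}^D\Gamma_{ij}{}^k\}\partial_{x_{j'}}$, $\mathfrak{J}\partial_{x_{i'}}=-\partial_{x_{i'}}$. $\mathcal{P}(N)$ is the bundle over $N$ of $g_N$-non-degenerate $\mathfrak{J}$-invariant tangent 2-planes. For $\pi\in\mathcal{P}(N)$ choose $\xi\in\pi$ with $g_N(\xi,\xi)=1$; the para-complex Jacobi operator is ${}^{g_N}\mathcal{J}(\pi):={}^{g_N}\mathcal{J}(\xi)-{}^{g_N}\mathcal{J}(\mathfrak{J}\xi)$, which is independent of the choice of $\xi$. $(N,g_N,\mathfrak{J})$ is Jordan semi para-complex Osserman if the Jordan normal form of ${}^{g_N}\mathcal{J}(\pi)$ is constant for $\pi\in\mathcal{P}(N)$. *)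

(* Defs.v *)
From HB Require Import structures.
From mathcomp Require Import all_boot all_order all_algebra.
From mathcomp Require Import all_classical all_reals all_analysis.
From mathcomp Require Import complex.

Set Implicit Arguments.
Unset Strict Implicit.
Unset Printing Implicit Defensive.

Import Order.TTheory GRing.Theory Num.Theory.
Import numFieldNormedType.Exports.

Local Open Scope classical_set_scope.
Local Open Scope ring_scope.

(* Tangent vectors are row vectors of components in a coordinate chart, and an
   endomorphism of a tangent space is the matrix A acting by v |-> v *m A.    *)

Section Calculus.
Variables (R : realType) (m : nat).

Definition basis_vec (i : 'I_m) : 'rV[R]_m := delta_mx 0 i.

Fixpoint Ck (k : nat) (U : set 'rV[R]_m) (f : 'rV[R]_m -> R) : Prop :=
  if k is k'.+1 then
    forall i : 'I_m, (forall p, U p -> derivable f p (basis_vec i)) /\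
                     Ck k' U (fun p => 'D_(basis_vec i) f p)
  else forall p, U p -> {for p, continuous f}.

(* Meant for open U. *)
Definition smooth_on (U : set 'rV[R]_m) (f : 'rV[R]_m -> R) : Prop :=
  forall k, Ck k U f.

End Calculus.

Section Manifolds.
Variables (R : realType) (n : nat).

(* chart_inv is only meaningful on the image chart_map @` chart_dom. *)
Record chart (M : topologicalType) := Chart {
  chart_dom : set M;
  chart_map : M -> 'rV[R]_n;
  chart_inv : 'rV[R]_n -> M;
  chart_dom_open : open chart_dom;
  chart_img_open : open (chart_map @` chart_dom);
  chart_mapK : forall p, chart_dom p -> chart_inv (chart_map p) = p;
  chart_map_continuous :
    forall p, chart_dom p -> {for p, continuous chart_map};
  chart_inv_continuous :
    forall x, (chart_map @` chart_dom) x -> {for x, continuous chart_inv}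
}.

Record smooth_manifold := SmoothManifold {
  mcarrier :> topologicalType;
  mhausdorff : hausdorff_space mcarrier;
  msecond_countable : @second_countable mcarrier;
  mindex : Type;
  matlas : mindex -> chart mcarrier;
  matlas_cover : forall p : mcarrier, exists a, chart_dom (matlas a) p;
  matlas_smooth : forall (a b : mindex) (l : 'I_n),
    smooth_on
      (chart_map (matlas a) @`
         (chart_dom (matlas a) `&` chart_dom (matlas b)))
      (fun x => chart_map (matlas b) (chart_inv (matlas a) x) 0 l)
}.

Variable M : smooth_manifold.

Definition dom (a : mindex M) : set M := chart_dom (matlas a).
Definition coord (a : mindex M) (p : M) : 'rV[R]_n := chart_map (matlas a) p.

(* l-th component of the change of coordinates from chart a to chart b *)
Definition trans (a b : mindex M) (l : 'I_n) (x : 'rV[R]_n) : R :=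
  coord b (chart_inv (matlas a) x) 0 l.

(* (d y^l / d x^i) for x, y the coordinates of the charts a, b *)
Definition dtrans (a b : mindex M) (i l : 'I_n) (x : 'rV[R]_n) : R :=
  'D_(basis_vec R i) (trans a b l) x.

End Manifolds.

Section CoordinateConnections.
Variables (R : realType) (m : nat).

(* Christoffel symbols: Gam i j k p is Gamma_{ij}^k at p, that is
   D_{d_i} d_j = sum_k Gamma_{ij}^k d_k. *)
Definition christoffel := 'I_m -> 'I_m -> 'I_m -> 'rV[R]_m -> R.

Definition vfield := 'rV[R]_m -> 'rV[R]_m.

Definition vder (X Y : vfield) : vfield := fun p =>
  \row_k 'D_(X p) (fun q => Y q 0 k) p.

Definition cov (Gam : christoffel) (X Y : vfield) : vfield := fun p =>
  vder X Y p + \row_k \sum_i \sum_j Gam i j k p * X p 0 i * Y p 0 j.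

Definition bracket (X Y : vfield) : vfield := fun p => vder X Y p - vder Y X p.

Definition torsion (Gam : christoffel) (X Y : vfield) : vfield := fun p =>
  cov Gam X Y p - cov Gam Y X p - bracket X Y p.

Definition curvature (Gam : christoffel) (X Y Z : vfield) : vfield := fun p =>
  cov Gam X (cov Gam Y Z) p - cov Gam Y (cov Gam X Z) p
  - cov Gam (bracket X Y) Z p.

(* The value of a tensor on tangent vectors is computed on the vector fields
   with the same constant components. *)
Definition torsion_at (Gam : christoffel) (p x y : 'rV[R]_m) : 'rV[R]_m :=
  torsion Gam (cst x) (cst y) p.

Definition curvature_at (Gam : christoffel) (p x y z : 'rV[R]_m) : 'rV[R]_m :=
  curvature Gam (cst x) (cst y) (cst z) p.

Definition jacobi (Gam : christoffel) (p x : 'rV[R]_m) : 'M[R]_m :=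
  lin1_mx (fun y => curvature_at Gam p y x x).

Definition levi_civita (g : 'rV[R]_m -> 'M[R]_m) : christoffel :=
  fun i j k p => 2^-1 * \sum_l invmx (g p) k l *
    ('D_(basis_vec R i) (fun q => g q j l) p
     + 'D_(basis_vec R j) (fun q => g q i l) p
     - 'D_(basis_vec R l) (fun q => g q i j) p).

Definition bilin (g : 'M[R]_m) (u v : 'rV[R]_m) : R := (u *m g *m v^T) 0 0.

End CoordinateConnections.

(* A torsion-free connection D on TM, given by its Christoffel symbols in the
   charts of M.  With x, y the coordinates of the charts a, b, conn_trans
   equates the y^l-components of D_{d/dx^i} d/dx^j computed in a and in b. *)
Record affine_connection (R : realType) (n : nat) (M : smooth_manifold R n) :=
  AffineConnection {
  conn :> mindex M -> christoffel R n;
  conn_smooth : forall (a : mindex M) (i j k : 'I_n),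
    smooth_on (coord a @` dom a) (conn a i j k);
  conn_trans : forall (a b : mindex M) (p : M) (i j l : 'I_n),
    dom a p -> dom b p ->
    let x := coord a p in
    let y := coord b p in
    \sum_k conn a i j k x * dtrans a b k l x =
    'D_(basis_vec R i) (dtrans a b j l) x
    + \sum_r \sum_s conn b r s l y * dtrans a b i r x * dtrans a b j s x;
  conn_torsion_free : forall (a : mindex M) (p : M) (u v : 'rV[R]_n),
    dom a p -> torsion_at (conn a) (coord a p) u v = 0
}.

Definition nilpotent_mx (F : pzRingType) (m : nat) (A : 'M[F]_m) : Prop :=
  exists k, A ^+ k = 0.

Definition affine_osserman (R : realType) (n : nat) (M : smooth_manifold R n)
    (D : affine_connection M) : Prop :=
  forall (a : mindex M) (p : M) (X : 'rV[R]_n),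
    dom a p -> nilpotent_mx (jacobi (D a) (coord a p) X).

(* A point of N = T^*M: a base point p with a covector at p, given by the
   components x_{i'} of w = x_{i'} dx^i in each chart (the components in the
   charts around p are compatible, the other ones are irrelevant). *)
Record cotangent (R : realType) (n : nat) (M : smooth_manifold R n) :=
  Cotangent {
  cbase : M;
  ccomp : mindex M -> 'rV[R]_n;
  ccomp_trans : forall (a b : mindex M) (i : 'I_n),
    dom a cbase -> dom b cbase ->
    ccomp a 0 i = \sum_l ccomp b 0 l * dtrans a b i l (coord a cbase)
}.

Section ModifiedExtension.
Variables (R : realType) (n : nat).

(* In local coordinates, a point of T^*M is row_mx x x', where x are the
   coordinates of the base point and x' those of the covector. *)
Section Coordinates.
Variable Gam : christoffel R n.

Definition hmx (q : 'rV[R]_(n + n)) : 'M[R]_n :=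
  let x := lsubmx q in let w := rsubmx q in
  \matrix_(i, j) (w 0 i * w 0 j - 2 * \sum_k w 0 k * Gam i j k x).

Definition gN (q : 'rV[R]_(n + n)) : 'M[R]_(n + n) :=
  block_mx (hmx q) 1%:M 1%:M 0.

Definition JN (q : 'rV[R]_(n + n)) : 'M[R]_(n + n) :=
  block_mx 1%:M (- hmx q) 0 (- 1%:M).

Definition jacobiN (q v : 'rV[R]_(n + n)) : 'M[R]_(n + n) :=
  jacobi (levi_civita gN) q v.

Definition para_complex_plane (q : 'rV[R]_(n + n))
    (pi : {vspace 'rV[R]_(n + n)}) : Prop :=
  [/\ \dim pi = 2%N,
      forall v, v \in pi -> v *m JN q \in pi &
      forall v, v \in pi ->
        (forall w, w \in pi -> bilin (gN q) v w = 0) -> v = 0].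

(* A is the operator J(pi) = J(xi) - J(JN xi), for some unit xi in pi; it does
   not depend on xi. *)
Definition is_para_complex_jacobi (q : 'rV[R]_(n + n))
    (pi : {vspace 'rV[R]_(n + n)}) (A : 'M[R]_(n + n)) : Prop :=
  exists xi, [/\ xi \in pi, bilin (gN q) xi xi = 1 &
                 A = jacobiN q xi - jacobiN q (xi *m JN q)].

End Coordinates.

Variables (M : smooth_manifold R n) (D : affine_connection M).

Definition ccoord (a : mindex M) (nu : cotangent M) : 'rV[R]_(n + n) :=
  row_mx (coord a (cbase nu)) (ccomp nu a).

(* A is the matrix, in the coordinates induced by a chart around the base
   point, of J(pi) for some pi in P(N). *)
Definition para_complex_jacobi_operator (A : 'M[R]_(n + n)) : Prop :=
  exists (a : mindex M) (nu : cotangent M) (pi : {vspace 'rV[R]_(n + n)}),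
    [/\ dom a (cbase nu),
        para_complex_plane (D a) (ccoord a nu) pi &
        is_para_complex_jacobi (D a) (ccoord a nu) pi A].

End ModifiedExtension.

Section Jordan.
Variable F : fieldType.

Definition jordan_block (d : nat) (lam : F) : 'M[F]_d :=
  \matrix_(i, j) (lam *+ (i == j) + (i.+1 == j :> nat)%:R).

Definition jordan_matrix (m : nat) (J : 'M[F]_m) : Prop :=
  exists (k : nat) (d : 'I_k -> nat) (lam : 'I_k -> F)
         (e : (\sum_(i < k) d i = m)%N),
    J = castmx (e, e) (\mxdiag_(i < k) jordan_block (d i) (lam i)).

Definition jordan_normal_form (m : nat) (A J : 'M[F]_m) : Prop :=
  jordan_matrix J /\ similar_in unitmx A J.

End Jordan.

Definition complexify (R : realType) (m : nat) (A : 'M[R]_m) : 'M[R[i]]_m :=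
  map_mx (real_complex R) A.

Definition jordan_semi_para_complex_osserman (R : realType) (n : nat)
    (M : smooth_manifold R n) (D : affine_connection M) : Prop :=
  exists J : 'M[R[i]]_(n + n),
    forall A, para_complex_jacobi_operator D A ->
      jordan_normal_form (complexify A) J.

(* Main.v *)
Require Import Defs.
From mathcomp Require Import all_boot all_order all_algebra.
From mathcomp Require Import all_classical all_reals all_analysis.
From mathcomp Require Import complex ring lra.


(* Take M = R^n with D_{d_2} d_2 = x_0 d_1 and all other D_{d_i} d_j = 0
   (coordinates numbered from 0).  The curvature of D is
   R(x,y)z = (x_0 y_2 - y_0 x_2) z_2 d_1, so every Jacobi operator of D squares
   to zero.  At the origin q of T^*M the first-order part of g_N vanishes and
   g_N(q) is a quadratic polynomial, so the curvature of g_N at q is algebraic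
   in the polarization of that quadratic part.  For xi = (e_0, b) with
   b_0 = 1/2, the para-complex plane spanned by (e_0, 0) and (0, b) has Jacobi
   operator [[1/2 + b^T e_0, 4 b_1 E_22], [0, 1/2 + e_0^T b]].  It is diagonal
   for b = e_0/2; if b_1 <> 0 and b_2 = 0, the vector (e_2, 0) is killed by
   (A - 1/2)^2 but not by A - 1/2, so A is not diagonalizable. *)

Set Implicit Arguments.
Unset Strict Implicit.
Unset Printing Implicit Defensive.

Import Order.TTheory GRing.Theory Num.Theory.
Import numFieldNormedType.Exports.

Local Open Scope classical_set_scope.
Local Open Scope ring_scope.

(** * Derivatives, smoothness and second countability on [R^n] *)

Section DirectionalDerivatives.
Variable R : realType.

(* Covers at once quadratic functions and products of a continuous function
   with a linear one at the origin, for which no derivative of the continuous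
   factor is needed. *)
Lemma is_derive_line (V : normedModType R) (f : V -> R) (p v : V) (r : R -> R) :
  (forall h, f (h *: v + p) = f p + h * r h) -> {for 0, continuous r} ->
  is_derive p v f (r 0).
Proof.
move=> fE rc.
have cv : (fun h => h^-1 *: ((f \o shift p) (h *: v) - f p)) @ 0^' --> r 0.
  move: rc => /continuous_withinNx rc; apply: cvg_trans rc.
  apply: near_eq_cvg; near=> h.
  rewrite /= fE addrAC subrr add0r [_ *: _]mulrA mulVf ?mul1r//.
  by near: h; exact: nbhs_dnbhs_neq.
split; first by apply/cvg_ex; exists (r 0).
exact: cvg_lim cv.
Unshelve. all: by end_near. Qed.

Lemma is_derive_coord n (p v : 'rV[R]_n) (l : 'I_n) :
  is_derive p v (fun q : 'rV[R]_n => q 0 l) (v 0 l).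
Proof.
apply: (@is_derive_line _ _ _ _ (fun=> v 0 l)); last exact: cst_continuous.
by move=> h; rewrite !mxE addrC.
Qed.

Lemma derive_coord n (p v : 'rV[R]_n) (l : 'I_n) :
  'D_v (fun q : 'rV[R]_n => q 0 l) p = v 0 l.
Proof. exact: (@derive_val _ _ _ _ _ _ _ (is_derive_coord p v l)). Qed.

Lemma smooth_cst n (U : set 'rV[R]_n) (c : R) : smooth_on U (cst c).
Proof.
move=> k; elim: k c => [c p _|k IH c i] /=; first exact: cst_continuous.
split=> [p _|]; first exact: derivable_cst.
suff -> : 'D_(basis_vec R i) (cst c : 'rV[R]_n -> R) = cst 0 by exact: IH.
by apply/funext => p; rewrite derive_cst.
Qed.

Lemma smooth_coord n (U : set 'rV[R]_n) (l : 'I_n) :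
  smooth_on U (fun q => q 0 l).
Proof.
case=> [p _|k i] /=; first exact: coord_continuous.
split=> [p _|]; first by case: (is_derive_coord p (basis_vec R i) l).
suff -> : 'D_(basis_vec R i) (fun q : 'rV[R]_n => q 0 l) =
          cst (basis_vec R i 0 l) by exact: smooth_cst.
by apply/funext => p; rewrite derive_coord.
Qed.

Lemma vder_cst n (X : vfield R n) (y : 'rV[R]_n) : vder X (cst y) = cst 0.
Proof. by apply/funext => p; apply/rowP => k; rewrite !mxE derive_cst. Qed.

Lemma bracket_cst n (x y : 'rV[R]_n) : bracket (cst x) (cst y) = cst 0.
Proof. by apply/funext => p; rewrite /bracket !vder_cst subrr. Qed.

Lemma cov_cst0 n (Gam : christoffel R n) (Z : vfield R n) :
  cov Gam (cst 0) Z = cst 0.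
Proof.
apply/funext => p; apply/rowP => k; rewrite !mxE derive0 add0r.
by apply: big1 => i _; apply: big1 => j _; rewrite mxE mulr0 mul0r.
Qed.

(** The balls with rational centre and radius [1/(k+1)] form a countable basis. *)
Lemma second_countable_rV n : @second_countable 'rV[R]_n.
Proof.
pose F (mk : 'rV[rat]_n * nat) : set 'rV[R]_n :=
  ball (map_mx ratr mk.1 : 'rV[R]_n) (mk.2.+1%:R^-1 : R).
exists (range F); first exact: card_le_trans (card_image_le _ _) (countableP _).
split=> [_ [mk _ <-]|x V /nbhs_ballP[e /= e0 eV]].
  exact: ball_open.
(* With radius below [e/2], a ball whose rational centre is that close to [x] contains [x] and stays
   inside the [e]-ball around [x]. *)
have [|k] := @ltr_add_invr R 0 (e / 2); first by rewrite divr_gt0.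
rewrite add0r => ke; set d := k.+1%:R^-1 in ke.
have d0 : 0 < d :> R by rewrite invr_gt0.
have q_ (i : 'I_n) : {q : rat | `|ratr q - x 0 i| < d}.
  apply: cid; have /rat_in_itvoo[q] : x 0 i - d < x 0 i + d.
    by rewrite ltrBlDr -addrA ltrDl addr_gt0.
  by rewrite in_itv/= => qd; exists q; rewrite ltr_distl.
pose m : 'rV[rat]_n := \row_i sval (q_ i).
have mx : ball (map_mx ratr m : 'rV[R]_n) d x.
  split=> // i j; rewrite !mxE (ord1 i) /=; exact: (svalP (q_ j)).
exists (F (m, k)); first by split; [exists (m, k)|].
move=> y /= my; apply: eV; rewrite [e]splitr.
apply: (@ball_triangle _ _ (map_mx ratr m : 'rV[R]_n)).
  exact/(le_ball (ltW ke))/ball_sym.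
exact: (le_ball (ltW ke)).
Qed.

End DirectionalDerivatives.

(** * Two criteria on diagonalizability *)

Section Diagonalizability.
Variable F : fieldType.

(** In an eigenbasis, [A - lam] multiplies the coordinate [u_i] by [d_i - lam], and in a field
    [u_i (d_i - lam)^2 = 0] forces [u_i (d_i - lam) = 0]. *)
Lemma diagonalizable_ker_sqr N (A : 'M[F]_N) (lam : F) (v : 'rV[F]_N) :
  diagonalizable A -> v *m (A - lam%:M) *m (A - lam%:M) = 0 ->
  v *m (A - lam%:M) = 0.
Proof.
case=> P Pu /(similar_diagPex)[d /(similarP Pu) PA].
set B := A - _; set D := diag_mx d - lam%:M.
have PB : P *m B = D *m P by rewrite mulmxBr mulmxBl PA scalar_mxC.
set u := v *m invmx P.
have vB : v *m B = u *m D *m P by rewrite -mulmxA -PB mulmxA mulmxKV.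
rewrite vB -mulmxA PB mulmxA -[RHS](mul0mx _ P) => /(can_inj (mulmxK Pu)) u0.
suff -> : u *m D = 0 by rewrite mul0mx.
have e (w : 'rV[F]_N) i : (w *m D) 0 i = w 0 i * (d 0 i - lam).
  by rewrite mulmxBr mul_mx_diag mul_mx_scalar !mxE; ring.
apply/rowP => i; move/rowP/(_ i): u0; rewrite !e !mxE => /eqP.
by rewrite -mulrA mulf_eq0 mulf_eq0 orbb -mulf_eq0 => /eqP.
Qed.

(** Conjugating through the common [J] carries [B] to the diagonal [A]. Thus one diagonal operator
    rules out a Jordan form shared with a non-diagonalizable one. *)
Lemma similar_diag_diagonalizable N (A B J : 'M[F]_N) :
  is_diag_mx A -> similar_in unitmx A J -> similar_in unitmx B J ->
  diagonalizable B.
Proof.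
move=> Ad [P Pu /(similarP Pu) PA] [Q Qu /(similarP Qu) QB].
have Wu : invmx P *m Q \in unitmx by rewrite unitmx_mul unitmx_inv Pu.
exists (invmx P *m Q) => //.
suff /eqP BA : similar (invmx P *m Q) B A by rewrite /similar_to BA.
by apply/similarP => //; rewrite -mulmxA QB !mulmxA -[A](mulKmx Pu) PA !mulmxA mulmxK.
Qed.

End Diagonalizability.

(** * Curvature at the origin of a metric that is constant plus quadratic *)

Section CurvatureAtOrigin.
Variable R : realType.

Lemma is_derive_sum_fun (V : normedModType R) n (f : 'I_n -> V -> R) (p v : V)
    (df : 'I_n -> R) :
  (forall i, is_derive p v (f i) (df i)) ->
  is_derive p v (fun q => \sum_i f i q) (\sum_i df i).
Proof.
move=> fd; suff -> : (fun q => \sum_i f i q) = \sum_i f i by exact: is_derive_sum.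
by apply/funext => q; rewrite fct_sumE.
Qed.

Lemma is_derive_mulr (V : normedModType R) (f : V -> R) (p v : V) (df c : R) :
  is_derive p v f df -> is_derive p v (fun q => f q * c) (df * c).
Proof.
move=> fd; have := is_deriveM fd (is_derive_cst c p v).
by rewrite scaler0 add0r [_ *: _]mulrC.
Qed.

(** The terms of the curvature quadratic in [Gam] die at the origin and constant fields commute, so
    only the first derivatives [dG] remain. *)
Lemma curvature_at_vanishing n (Gam : christoffel R n)
    (dG : 'I_n -> 'I_n -> 'I_n -> 'rV[R]_n -> R) (x y z : 'rV[R]_n) :
  (forall i j k, Gam i j k 0 = 0) ->
  (forall i j k v, is_derive (0 : 'rV[R]_n) v (Gam i j k) (dG i j k v)) ->
  curvature_at Gam 0 x y z =
  \row_k \sum_i \sum_j (dG i j k x * y 0 i * z 0 j - dG i j k y * x 0 i * z 0 j).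
Proof.
move=> G0 dGE.
have cov0 (X Y : vfield R n) : cov Gam X Y 0 = vder X Y 0.
  apply/rowP => k; rewrite !mxE [X in _ + X]big1 ?addr0 // => i _.
  by apply: big1 => j _; rewrite G0 !mul0r.
have covc u w k : 'D_u (fun q => cov Gam (cst w) (cst z) q 0 k) 0 =
    \sum_i \sum_j dG i j k u * w 0 i * z 0 j.
  have -> : (fun q => cov Gam (cst w) (cst z) q 0 k) =
            (fun q => \sum_i \sum_j Gam i j k q * w 0 i * z 0 j).
    by apply/funext => q; rewrite /cov vder_cst !mxE add0r.
  apply: (@derive_val _ _ _ _ _ _ _ (is_derive_sum_fun _)) => i.
  by apply: is_derive_sum_fun => j; do 2!apply: is_derive_mulr.
rewrite /curvature_at /curvature bracket_cst cov_cst0 subr0 !cov0.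
apply/rowP => k; rewrite !mxE !covc -sumrB; apply: eq_bigr => i _.
by rewrite -sumrB.
Qed.

Section QuadraticMetric.
Variables (m : nat) (G : 'rV[R]_m -> 'M[R]_m) (Q : 'rV[R]_m -> 'rV[R]_m -> 'M[R]_m).
Hypotheses (Qlin : forall q, linear (Q ^~ q)) (Qsym : forall p q, Q p q = Q q p).
Hypothesis GQ : forall q, G q = G 0 + Q q q.
Hypotheses (G0u : G 0 \in unitmx) (Gtr : forall q, (G q)^T = G q).
(** Continuity along lines through the origin is enough: the Christoffel symbols are the inverse
    metric times a linear factor vanishing at the origin, so the inverse is never differentiated. *)
Hypothesis Ginv_cont : forall v k l,
  {for 0, continuous (fun h : R => invmx (G (h *: v)) k l : R)}.

Let QD p1 p2 q : Q (p1 + p2) q = Q p1 q + Q p2 q.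
Proof. by have := Qlin q 1 p1 p2; rewrite !scale1r. Qed.

Let Q0 q : Q 0 q = 0.
Proof. by apply: (addrI (Q 0 q)); rewrite -QD !addr0. Qed.

Let QZ a p q : Q (a *: p) q = a *: Q p q.
Proof. by have := Qlin q a p 0; rewrite Q0 !addr0. Qed.

Let Q_basis p q i j : Q p q i j = \sum_k p 0 k * Q (basis_vec R k) q i j.
Proof.
rewrite {1}[p]row_sum_delta.
have -> : Q (\sum_j p 0 j *: delta_mx 0 j) q =
          \sum_k p 0 k *: Q (basis_vec R k) q.
  rewrite (big_morph (Q ^~ q) (fun p1 p2 => QD p1 p2 q) (Q0 q)).
  by apply: eq_bigr => k _; rewrite QZ.
by rewrite summxE; apply: eq_bigr => k _; rewrite mxE.
Qed.

Let Qtr p q : (Q p q)^T = Q p q.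
Proof.
have Qqtr r : (Q r r)^T = Q r r.
  by have := Gtr r; rewrite GQ linearD /= Gtr => /addrI.
apply/matrixP => i j; move/matrixP/(_ i j): (Qqtr (p + q)).
have /matrixP/(_ i j) := Qqtr p; have /matrixP/(_ i j) := Qqtr q.
by rewrite !QD ![Q _ (p + q)]Qsym !QD (Qsym q p) !mxE; lra.
Qed.

(** Christoffel symbols of the first kind of [G]: the derivative of [Q q q] along [v] is [2 Q v q],
    and this 2 cancels the 1/2 of the Levi-Civita formula. *)
Let first_kind i j l q : R :=
  Q (basis_vec R i) q j l + Q (basis_vec R j) q i l - Q (basis_vec R l) q i j.

Let derive_metric i j l q :
  'D_(basis_vec R i) (fun q => G q j l) q = 2 * Q (basis_vec R i) q j l.
Proof.
set v := basis_vec R i.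
(* The remainder is read off from [Q (q + h v) (q + h v) = Q q q + h (2 Q v q + h Q v v)]. *)
have := @is_derive_line R _ (fun q => G q j l) q v
  (fun h => 2 * Q v q j l + h * Q v v j l).
rewrite mul0r addr0; case => // [h|].
  rewrite !(GQ (_ + q)) (GQ q) !QD !QZ ![Q _ (_ + q)]Qsym !QD !QZ (Qsym q v).
  by rewrite !mxE; ring.
apply: continuousD; first exact: cst_continuous.
by apply: continuousM; [exact: cvg_id|exact: cst_continuous].
Qed.

Let levi_civitaE i j k q :
  levi_civita G i j k q = \sum_l invmx (G q) k l * first_kind i j l q.
Proof.
rewrite /levi_civita mulr_sumr; apply: eq_bigr => l _.
by rewrite !derive_metric /first_kind; field.
Qed.

Let first_kind_scale i j l h q : first_kind i j l (h *: q) = h * first_kind i j l q.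
Proof. by rewrite /first_kind ![Q _ (h *: q)]Qsym !QZ !mxE !(Qsym q); ring. Qed.

(** Since [first_kind] is linear in the point, the symbol at [h v] is [h] times a function
    continuous at [h = 0], whose value there is the derivative. *)
Let is_derive_levi_civita i j k v :
  is_derive (0 : 'rV[R]_m) v (levi_civita G i j k)
    (\sum_l invmx (G 0) k l * first_kind i j l v).
Proof.
have := @is_derive_line R _ (levi_civita G i j k) 0 v
  (fun h => \sum_l invmx (G (h *: v)) k l * first_kind i j l v).
rewrite scale0r; apply=> [h|].
  rewrite addr0 !levi_civitaE [X in _ = X + _]big1 => [|l _].
    by rewrite add0r mulr_sumr; apply: eq_bigr => l _; rewrite first_kind_scale mulrCA.
  by rewrite -{2}(scale0r 0) first_kind_scale mul0r mulr0.
apply: cvg_big => [|l _]; first exact: add_continuous.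
by apply: cvgM; [exact: Ginv_cont|exact: cvg_cst].
Qed.

Let sum_first_kind (x y z : 'rV[R]_m) l :
  \sum_i \sum_j first_kind i j l x * y 0 i * z 0 j =
  (z *m Q y x) 0 l + (y *m Q z x) 0 l - bilin (Q (basis_vec R l) x) y z.
Proof.
rewrite /bilin !mxE.
have -> : \sum_j z 0 j * Q y x j l =
    \sum_i \sum_j Q (basis_vec R i) x j l * y 0 i * z 0 j.
  rewrite exchange_big; apply: eq_bigr => j _; rewrite Q_basis mulr_sumr.
  by apply: eq_bigr => i _; ring.
have -> : \sum_j y 0 j * Q z x j l =
    \sum_i \sum_j Q (basis_vec R j) x i l * y 0 i * z 0 j.
  apply: eq_bigr => i _; rewrite Q_basis mulr_sumr.
  by apply: eq_bigr => j _; ring.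
have -> : \sum_j (y *m Q (basis_vec R l) x) 0 j * z^T j 0 =
    \sum_i \sum_j Q (basis_vec R l) x i j * y 0 i * z 0 j.
  rewrite exchange_big; apply: eq_bigr => j _; rewrite !mxE mulr_suml.
  by apply: eq_bigr => i _; ring.
rewrite -big_split -sumrB; apply: eq_bigr => i _ /=.
by rewrite -big_split -sumrB; apply: eq_bigr => j _ /=; rewrite /first_kind; ring.
Qed.

(* Lowering the last index with [G 0] removes the inverse metric. *)
Lemma curvature_quadratic_metric (x y z : 'rV[R]_m) :
  curvature_at (levi_civita G) 0 x y z *m G 0 =
  \row_l ((y *m Q z x) 0 l - (x *m Q z y) 0 l
          + bilin (Q (basis_vec R l) y) x z - bilin (Q (basis_vec R l) x) y z).
Proof.
have lc0 i j k : levi_civita G i j k 0 = 0.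
  rewrite levi_civitaE big1 // => l _.
  by rewrite -{2}(scale0r 0) first_kind_scale mul0r mulr0.
rewrite (curvature_at_vanishing _ _ _ lc0 is_derive_levi_civita).
set r := \row_l _.
rewrite -[RHS](mulmxKV G0u); congr (_ *m _).
apply/rowP => k; rewrite !mxE.
have invT l : invmx (G 0) k l = invmx (G 0) l k.
  by rewrite -{1}(Gtr 0) -trmx_inv mxE.
transitivity (\sum_i \sum_j \sum_l (first_kind i j l x * y 0 i * z 0 j
      - first_kind i j l y * x 0 i * z 0 j) * invmx (G 0) l k).
  apply: eq_bigr => i _; apply: eq_bigr => j _.
  rewrite -!mulrA !mulr_suml -sumrB; apply: eq_bigr => l _; rewrite invT; ring.
under eq_bigr do rewrite exchange_big.
rewrite exchange_big; apply: eq_bigr => l _ /=.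
under eq_bigr do rewrite -mulr_suml sumrB.
(* By symmetry of [Q], the terms [z *m Q y x] and [z *m Q x y] cancel in the antisymmetrization. *)
rewrite -mulr_suml sumrB !sum_first_kind (Qsym y x) mxE; ring.
Qed.

End QuadraticMetric.
End CurvatureAtOrigin.

(** * The shear connection, its curvature and its Jacobi operators *)

Section Shear.
Variables (R : realType) (n : nat) (i0 i1 i2 : 'I_n).
Hypotheses (i01 : i0 != i1) (i02 : i0 != i2) (i12 : i1 != i2).

Definition shear : christoffel R n := fun i j k p =>
  p 0 i0 *+ [&& i == i2, j == i2 & k == i1].

Local Notation e i := (delta_mx 0 i : 'rV[R]_n).

Lemma smooth_shear (U : set 'rV[R]_n) i j k : smooth_on U (shear i j k).
Proof.
rewrite /shear; case: [&& _, _ & _]; first exact: smooth_coord.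
exact: smooth_cst.
Qed.

Lemma sum_shear (p x y : 'rV[R]_n) :
  \row_k (\sum_i \sum_j shear i j k p * x 0 i * y 0 j) =
  (p 0 i0 * x 0 i2 * y 0 i2) *: e i1.
Proof.
apply/rowP => k; rewrite !mxE (bigD1 i2) //= [X in _ + X]big1 => [|i /negPf ne].
  rewrite addr0 (bigD1 i2) //= [X in _ + X]big1 => [|j /negPf ne].
    by rewrite addr0 /shear !eqxx /=; case: (k == i1); rewrite ?mulr1n ?mulr0n; ring.
  by rewrite /shear ne andbF mulr0n !mul0r.
by apply: big1 => j _; rewrite /shear ne mulr0n !mul0r.
Qed.

Lemma cov_shear (X Y : vfield R n) p :
  cov shear X Y p = vder X Y p + (p 0 i0 * X p 0 i2 * Y p 0 i2) *: e i1.
Proof. by rewrite /cov sum_shear. Qed.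

Lemma torsion_shear p (u v : 'rV[R]_n) : torsion_at shear p u v = 0.
Proof.
rewrite /torsion_at /torsion bracket_cst !cov_shear !vder_cst subr0 !add0r.
by rewrite mulrAC subrr.
Qed.

(** Covariant derivatives of constant fields point along [e i1], which has no [i2] component, so a
    second application of the connection only differentiates the coefficient. *)
Lemma curvature_shear p (x y z : 'rV[R]_n) :
  curvature_at shear p x y z =
  ((x 0 i0 * y 0 i2 - y 0 i0 * x 0 i2) * z 0 i2) *: e i1.
Proof.
have covc (w : 'rV[R]_n) : cov shear (cst w) (cst z) =
    fun q => (q 0 i0 * w 0 i2 * z 0 i2) *: e i1.
  by apply/funext => q; rewrite cov_shear vder_cst add0r.
have covcc (u w : 'rV[R]_n) : cov shear (cst u) (cov shear (cst w) (cst z)) p =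
    (u 0 i0 * w 0 i2 * z 0 i2) *: e i1.
  rewrite cov_shear covc !mxE eqxx eq_sym (negPf i12) !mulr0 scale0r addr0.
  apply/rowP => k; rewrite !mxE.
  have -> : (fun q : 'rV[R]_n => ((q 0 i0 * w 0 i2 * z 0 i2) *: e i1) 0 k) =
      fun q => q 0 i0 * w 0 i2 * z 0 i2 * e i1 0 k.
    by apply/funext => q; rewrite mxE.
  have D : is_derive p u (fun q : 'rV[R]_n => q 0 i0 * w 0 i2 * z 0 i2 * e i1 0 k)
      (u 0 i0 * w 0 i2 * z 0 i2 * e i1 0 k).
    by do 3!apply: is_derive_mulr; exact: is_derive_coord.
  by rewrite (@derive_val _ _ _ _ _ _ _ D) mxE.
rewrite /curvature_at /curvature bracket_cst cov_cst0 subr0 !covcc -scalerBl.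
by congr (_ *: _); ring.
Qed.

(** The image lies on the line of [e i1], which is itself killed because [i1] differs from [i0] and
    [i2]; hence the exponent 2. *)
Lemma nilpotent_jacobi_shear p (X : 'rV[R]_n) : nilpotent_mx (jacobi shear p X).
Proof.
have JE i j : jacobi shear p X i j =
    ((i == i0)%:R * X 0 i2 - X 0 i0 * (i == i2)%:R) * X 0 i2 * (j == i1)%:R.
  by rewrite mxE curvature_shear !mxE !eqxx /= ![_ == i]eq_sym.
exists 2; rewrite expr2 -mulmxE; apply/matrixP => i j; rewrite !mxE.
apply: big1 => k _; rewrite !JE.
have [->|_] := eqVneq k i1; last by rewrite mulr0 mul0r.
by rewrite (eq_sym i1) (negPf i01) (negPf i12) mul0r mulr0 subrr !mul0r mulr0.
Qed.

(** * The modified extension metric of the shear connection and its curvature at the origin *)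

Lemma hmx_shear (q : 'rV[R]_(n + n)) :
  hmx shear q = (rsubmx q)^T *m rsubmx q
    - (2 * rsubmx q 0 i1 * lsubmx q 0 i0) *: delta_mx i2 i2.
Proof.
apply/matrixP => i j; rewrite !mxE big_ord1 !mxE.
rewrite (bigD1 i1) //= [X in 2 * (_ + X)]big1 => [|k /negPf ne].
  rewrite /shear !eqxx addr0 andbT !mxE.
  by case: (i == i2); case: (j == i2); rewrite /= ?mulr1n ?mulr0n; ring.
by rewrite /shear ne !andbF mulr0n mulr0.
Qed.

(* The symmetric bilinear polarization of the quadratic map [hmx shear]. *)
Definition polar_h (p q : 'rV[R]_(n + n)) : 'M[R]_n :=
  2^-1 *: ((rsubmx p)^T *m rsubmx q + (rsubmx q)^T *m rsubmx p)
  - (rsubmx p 0 i1 * lsubmx q 0 i0 + rsubmx q 0 i1 * lsubmx p 0 i0)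
    *: delta_mx i2 i2.

Definition polar_g (p q : 'rV[R]_(n + n)) : 'M[R]_(n + n) :=
  block_mx (polar_h p q) 0 0 0.

Lemma hmx_shear0 : hmx shear 0 = 0.
Proof.
apply/matrixP => i j; rewrite hmx_shear !mxE big_ord1 !mxE; ring.
Qed.

Lemma gN_shear0 : gN shear 0 = block_mx 0 1%:M 1%:M 0.
Proof. by rewrite /gN hmx_shear0. Qed.

Lemma gN_shear0_sqr : gN shear 0 *m gN shear 0 = 1%:M.
Proof.
by rewrite gN_shear0 mulmx_block !(mulmx0, mul0mx, mulmx1, addr0, add0r)
  -scalar_mx_block.
Qed.

Lemma invmx_gN (q : 'rV[R]_(n + n)) :
  invmx (gN shear q) = block_mx 0 1%:M 1%:M (- hmx shear q).
Proof.
set H := block_mx _ _ _ _.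
have gH : gN shear q *m H = 1%:M.
  rewrite /gN /H mulmx_block !(mulmx0, mul0mx, mulmx1, mul1mx, addr0, add0r).
  by rewrite subrr -scalar_mx_block.
have [gu _] := mulmx1_unit gH.
by rewrite -[LHS]mulmx1 -gH mulKmx.
Qed.

Lemma curvature_shear_extension (x y z : 'rV[R]_(n + n)) :
  curvature_at (levi_civita (gN shear)) 0 x y z *m gN shear 0 =
  \row_l ((y *m polar_g z x) 0 l - (x *m polar_g z y) 0 l
    + bilin (polar_g (basis_vec R l) y) x z
    - bilin (polar_g (basis_vec R l) x) y z).
Proof.
apply: curvature_quadratic_metric.
- move=> q a p1 p2; rewrite /polar_g scale_block_mx add_block_mx !scaler0 !addr0.
  congr (block_mx _ 0 0 0); apply/matrixP => i j.
  by rewrite /polar_h !mxE !big_ord1 !mxE; ring.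
- move=> p q; rewrite /polar_g; congr (block_mx _ 0 0 0).
  by rewrite /polar_h addrC [in LHS]addrC; congr (_ *: _ - _ *: _); rewrite addrC.
- move=> q; rewrite gN_shear0 /gN /polar_g add_block_mx !add0r !addr0.
  congr (block_mx _ _ _ _); apply/matrixP => i j.
  by rewrite hmx_shear /polar_h !mxE !big_ord1 !mxE; field.
- by have [] := mulmx1_unit gN_shear0_sqr.
- move=> q; rewrite /gN tr_block_mx !trmx1 trmx0; congr (block_mx _ _ _ _).
  apply/matrixP => i j; rewrite hmx_shear !mxE !big_ord1 !mxE [(j == i2) && _]andbC.
  ring.
- move=> v k l.
  (* [hmx shear] is homogeneous of degree 2, so along a line the inverse metric is a constant plus
     [h^2] times a constant. *)
  have -> : (fun h : R => invmx (gN shear (h *: v)) k l : R) =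
    fun h => (block_mx 0 1%:M 1%:M 0 : 'M[R]_(n + n)) k l
             + h * h * (block_mx 0 0 0 (- hmx shear v) : 'M[R]_(n + n)) k l.
    apply/funext => h; rewrite invmx_gN.
    have -> : hmx shear (h *: v) = (h * h) *: hmx shear v.
      apply/matrixP => i j; rewrite !hmx_shear !mxE !big_ord1 !mxE; ring.
    have -> : block_mx 0 1%:M 1%:M (- ((h * h) *: hmx shear v)) =
      block_mx 0 1%:M 1%:M 0 + (h * h) *: block_mx 0 0 0 (- hmx shear v).
      by rewrite scale_block_mx add_block_mx !scaler0 !addr0 add0r scalerN.
    by rewrite [LHS]mxE; congr (_ + _); rewrite [LHS]mxE.
  apply: continuousD; first exact: cst_continuous.
  apply: continuousM; last exact: cst_continuous.
  by apply: continuousM; exact: cvg_id.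
Qed.

(** * Explicit Jacobi operators of the extension at the origin *)

Local Notation dot u v := ((u *m v^T) 0 0).

Lemma dot_el i (v : 'rV[R]_n) : dot (e i) v = v 0 i.
Proof. by rewrite -rowE !mxE. Qed.

Lemma dot_er i (v : 'rV[R]_n) : dot v (e i) = v 0 i.
Proof. by rewrite trmx_delta -colE mxE. Qed.

Lemma bilin_polar_g (p q u v : 'rV[R]_(n + n)) :
  bilin (polar_g p q) u v =
  2^-1 * (dot (lsubmx u) (rsubmx p) * dot (lsubmx v) (rsubmx q)
          + dot (lsubmx u) (rsubmx q) * dot (lsubmx v) (rsubmx p))
  - (rsubmx p 0 i1 * lsubmx q 0 i0 + rsubmx q 0 i1 * lsubmx p 0 i0)
    * (lsubmx u 0 i2 * lsubmx v 0 i2).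
Proof.
rewrite /bilin -{1}[u]hsubmxK -{1}[v]hsubmxK tr_row_mx mul_row_block !mulmx0 !addr0.
rewrite mul_row_col mul0mx addr0; set u' := lsubmx u; set v' := lsubmx v.
have dotC (w w' : 'rV[R]_n) : dot w w' = dot w' w.
  by rewrite -[in RHS](trmxK w') -trmx_mul [RHS]mxE.
rewrite (dotC v') (dotC v') /polar_h mulmxBr mulmxBl -!scalemxAr -!scalemxAl.
rewrite mulmxDr mulmxDl !mulmxA -[_ *m rsubmx q *m _]mulmxA -[_ *m rsubmx p *m _]mulmxA.
have outer (w w' w1 w2 : 'rV[R]_n) :
    (w *m w1^T *m (w2 *m w'^T)) 0 0 = dot w w1 * dot w2 w'.
  rewrite mxE. rewrite big_ord1. done.
(* [delta_mx i2 i2] is treated as one more rank-one product, of [e i2] with itself. *)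
have ee : (u' *m delta_mx i2 i2 *m v'^T) 0 0 = u' 0 i2 * v' 0 i2.
  rewrite -(mul_delta_mx (0 : 'I_1)) mulmxA -mulmxA -(trmx_delta _ (0 : 'I_1) i2).
  rewrite outer. rewrite dot_el dot_er. done.
have lin (a c : R) (A B C : 'M[R]_1) :
    (a *: (A + B) - c *: C) 0 0 = a * (A 0 0 + B 0 0) - c * C 0 0.
  by rewrite !mxE.
by rewrite lin !outer ee.
Qed.

Lemma mulmx_bilin m (A : 'M[R]_m) (u : 'rV[R]_m) l :
  (u *m A) 0 l = bilin A u (basis_vec R l).
Proof. by rewrite /bilin trmx_delta -colE [RHS]mxE. Qed.

Lemma jacobiN_mul_gN (xi : 'rV[R]_(n + n)) i l :
  (jacobiN shear 0 xi *m gN shear 0) i l =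
  bilin (polar_g xi (basis_vec R i)) xi (basis_vec R l)
  - bilin (polar_g xi xi) (basis_vec R i) (basis_vec R l)
  + bilin (polar_g (basis_vec R l) xi) (basis_vec R i) xi
  - bilin (polar_g (basis_vec R l) (basis_vec R i)) xi xi.
Proof.
rewrite -!mulmx_bilin.
have := curvature_shear_extension (basis_vec R i) xi xi.
move/rowP/(_ l); rewrite [RHS]mxE => <-.
by rewrite !mxE; apply: eq_bigr => k _; rewrite /jacobiN /jacobi mxE.
Qed.

Lemma lsub_basisl i : lsubmx (basis_vec R (lshift n i) : 'rV_(n + n)) = e i :> 'rV_n.
Proof. by apply/rowP => j; rewrite !mxE (inj_eq (@lshift_inj _ _)). Qed.

Lemma lsub_basisr i : lsubmx (basis_vec R (rshift n i) : 'rV_(n + n)) = 0 :> 'rV_n.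
Proof. by apply/rowP => j; rewrite !mxE eq_lrshift. Qed.

Lemma rsub_basisl i : rsubmx (basis_vec R (lshift n i) : 'rV_(n + n)) = 0 :> 'rV_n.
Proof. by apply/rowP => j; rewrite !mxE eq_rlshift. Qed.

Lemma rsub_basisr i : rsubmx (basis_vec R (rshift n i) : 'rV_(n + n)) = e i :> 'rV_n.
Proof. by apply/rowP => j; rewrite !mxE (inj_eq (@rshift_inj _ _)). Qed.

Lemma dot0l (v : 'rV[R]_n) : dot (0 : 'rV[R]_n) v = 0.
Proof. by rewrite mul0mx mxE. Qed.

Lemma dot0r (v : 'rV[R]_n) : dot v (0 : 'rV[R]_n) = 0.
Proof. by rewrite trmx0 mulmx0 mxE. Qed.

Definition jacobi_pi (b : 'rV[R]_n) : 'M[R]_(n + n) :=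
  block_mx (2^-1%:M + b^T *m e i0) ((4 * b 0 i1) *: delta_mx i2 i2)
           0 (2^-1%:M + (e i0)^T *m b).

Lemma row_mx_JN (a b : 'rV[R]_n) : row_mx a b *m JN shear 0 = row_mx a (- b).
Proof.
by rewrite /JN hmx_shear0 oppr0 mul_row_block !mulmx0 mulmx1 addr0 add0r mulmxN mulmx1.
Qed.

(** At the origin [JN] only flips the sign of [b]. As the Jacobi operator is quadratic in its
    vector, the difference keeps twice the part mixed in [e i0] and [b]. *)
Lemma jacobi_piE (b : 'rV[R]_n) : b 0 i0 = 2^-1 ->
  jacobiN shear 0 (row_mx (e i0) b) - jacobiN shear 0 (row_mx (e i0) b *m JN shear 0)
  = jacobi_pi b.
Proof.
(* The metric at the origin is its own inverse; inserting its square lowers an index, so that both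
   sides can be compared entrywise through [jacobiN_mul_gN]. *)
move=> b0; rewrite row_mx_JN -[LHS]mulmx1 -gN_shear0_sqr mulmxA mulmxBl.
have -> : jacobi_pi b = block_mx ((4 * b 0 i1) *: delta_mx i2 i2)
    (2^-1%:M + b^T *m e i0) (2^-1%:M + (e i0)^T *m b) 0 *m gN shear 0.
  by rewrite gN_shear0 mulmx_block !(mulmx0, mulmx1, addr0, add0r).
congr (_ *m _); apply/matrixP => i l; rewrite mxE [X in _ + X]mxE !jacobiN_mul_gN.
rewrite !bilin_polar_g !row_mxKl !row_mxKr.
have andR (x y : bool) : (x && y)%:R = x%:R * y%:R :> R.
  by case: x; rewrite ?mul1r ?mul0r.
have b'0 : (- b) 0 i0 = - 2^-1 by rewrite mxE b0.
case: (split_ordP i) => {}i ->; case: (split_ordP l) => {}l ->;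
  rewrite ?block_mxEul ?block_mxEur ?block_mxEdl ?block_mxEdr
    ?lsub_basisl ?lsub_basisr ?rsub_basisl ?rsub_basisr
    ?dot0l ?dot0r ?dot_el ?dot_er ?b'0 ?b0.
all: rewrite !mxE ?big_ord1 ?mxE ?eqxx /= ?[i2 == _]eq_sym ?[l == i]eq_sym.
all: rewrite (negPf i02) ?[i0 == _]eq_sym ?[ord0]ord1.
all: rewrite ?(andR (i == i2) (l == i2)).
all: by case: (i == l); rewrite ?mulr1n ?mulr0n; field.
Qed.

(** * The para-complex planes and the diagonalizability of their operators *)

Lemma dotZ (s t : R) (u v : 'rV[R]_n) : dot (s *: u) (t *: v) = s * t * dot u v.
Proof. by rewrite linearZ /= -scalemxAl -scalemxAr scalerA [LHS]mxE. Qed.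

Lemma bilin_gN_shear0 (a b a' b' : 'rV[R]_n) :
  bilin (gN shear 0) (row_mx a b) (row_mx a' b') = dot a b' + dot b a'.
Proof.
rewrite /bilin gN_shear0 mul_row_block !(mulmx0, mulmx1, addr0, add0r).
by rewrite tr_row_mx mul_row_col mxE addrC.
Qed.

(** The generators are null vectors, in the [+1] and [-1] eigenspaces of [JN] at the origin; their
    mutual product is [b 0 i0]. *)
Definition shear_plane (b : 'rV[R]_n) : {vspace 'rV[R]_(n + n)} :=
  <<[:: row_mx (e i0) 0; row_mx 0 b]>>%VS.

Lemma shear_planeP (b : 'rV[R]_n) (v : 'rV[R]_(n + n)) :
  reflect (exists s t, v = row_mx (s *: e i0) (t *: b)) (v \in shear_plane b).
Proof.
have rowE s t : s *: row_mx (e i0) 0 + t *: row_mx 0 b = row_mx (s *: e i0) (t *: b).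
  by rewrite !scale_row_mx !scaler0 add_row_mx addr0 add0r.
rewrite /shear_plane span_cons span_seq1; apply: (iffP memv_addP).
  by case=> _ /vlineP[s ->] [_ /vlineP[t ->] ->]; exists s, t; rewrite rowE.
case=> s [t ->]; exists (s *: row_mx (e i0) 0); first exact/vlineP/ex_intro.
by exists (t *: row_mx 0 b); [exact/vlineP/ex_intro|rewrite rowE].
Qed.

Lemma para_complex_plane_shear (b : 'rV[R]_n) : b 0 i0 = 2^-1 ->
  para_complex_plane shear 0 (shear_plane b).
Proof.
move=> b0.
have half0 : 2^-1 != 0 :> R by rewrite invr_eq0 pnatr_eq0.
split.
- have fr : free [:: row_mx (e i0) 0; row_mx 0 b].
    rewrite free_cons span_seq1 seq1_free; apply/andP; split.
      apply/vlineP => -[k]; rewrite scale_row_mx scaler0 => /eq_row_mx[].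
      by move/rowP/(_ i0)/eqP; rewrite !mxE !eqxx oner_eq0.
    apply/eqP; rewrite -row_mx0 => /eq_row_mx[_ /rowP/(_ i0)/eqP].
    by rewrite b0 mxE (negPf half0).
  exact: (eqP fr).
- move=> _ /shear_planeP[s [t ->]]; rewrite row_mx_JN.
  by apply/shear_planeP; exists s, (- t); rewrite scaleNr.
- move=> _ /shear_planeP[s [t ->]] orth.
  have pair s' t' : s * (t' * 2^-1) + t * 2^-1 * s' = 0.
    rewrite -(orth (row_mx (s' *: e i0) (t' *: b))).
      by rewrite bilin_gN_shear0 !dotZ dot_el dot_er b0; ring.
    by apply/shear_planeP; exists s', t'.
  (* Pairing with each null generator isolates the coefficient of the other one. *)
  have := pair 1 0; have := pair 0 1.
  rewrite mul1r !mulr0 mul0r mulr0 addr0 mulr1 add0r => /eqP.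
  rewrite mulf_eq0 (negPf half0) orbF => /eqP -> /eqP.
  by rewrite mulf_eq0 (negPf half0) orbF => /eqP ->; rewrite !scale0r row_mx0.
Qed.

Lemma is_para_complex_jacobi_shear (b : 'rV[R]_n) : b 0 i0 = 2^-1 ->
  is_para_complex_jacobi shear 0 (shear_plane b) (jacobi_pi b).
Proof.
(* The sum of the two generators has square norm [2 b_{i0} = 1]. *)
move=> b0; exists (row_mx (e i0) b); rewrite jacobi_piE //; split=> //.
  by apply/shear_planeP; exists 1, 1; rewrite !scale1r.
by rewrite bilin_gN_shear0 dot_el dot_er b0; field.
Qed.

Lemma is_diag_jacobi_pi : is_diag_mx (complexify (jacobi_pi (2^-1 *: e i0))).
Proof.
apply/is_diag_mxP => i j ij; rewrite /complexify mxE.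
suff /is_diag_mxP/(_ i j ij) -> : is_diag_mx (jacobi_pi (2^-1 *: e i0)).
  by rewrite rmorph0.
rewrite /jacobi_pi !mxE (eq_sym i1) (negPf i01) andbF !mulr0 scale0r.
rewrite is_diag_block_mx //= !eqxx /=; apply/andP; split; apply/is_diag_mxP => k l kl;
  rewrite !mxE big_ord1 !mxE; have /negPf -> : k != l by [];
  by move: kl; have [->|_] := eqVneq k i0; have [->|_] := eqVneq l i0;
     rewrite ?eqxx //= ?mulr0 ?mul0r addr0.
Qed.

(** [A - 1/2] sends [(e_{i2}, 0)] to [(0, 4 b_{i1} e_{i2})], as [b_{i2} = 0]; it then sends that
    vector to 0, as [i0 != i2]. This contradicts [diagonalizable_ker_sqr]. *)
Lemma not_diagonalizable_jacobi_pi (b : 'rV[R]_n) :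
  b 0 i1 != 0 -> b 0 i2 = 0 -> ~ diagonalizable (complexify (jacobi_pi b)).
Proof.
move=> b1 b2 dg.
pose v : 'rV[R]_(n + n) := row_mx (e i2) 0.
(* Both products by [A - 1/2] are thereby computed over the reals. *)
have complexM m (A : 'M[R]_(m, n + n)) : 
    map_mx (real_complex R) A *m (complexify (jacobi_pi b) - (real_complex R 2^-1)%:M)
    = map_mx (real_complex R) (A *m (jacobi_pi b - 2^-1%:M)).
  by rewrite /complexify map_mxM map_mxB map_scalar_mx.
have half : jacobi_pi b - 2^-1%:M = block_mx (b^T *m e i0)
    ((4 * b 0 i1) *: delta_mx i2 i2) 0 ((e i0)^T *m b).
  rewrite /jacobi_pi scalar_mx_block opp_block_mx add_block_mx !oppr0 !addr0.
  by rewrite addrAC subrr add0r addrAC subrr add0r.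
have vA : v *m (jacobi_pi b - 2^-1%:M) = row_mx 0 ((4 * b 0 i1) *: e i2).
  rewrite half mul_row_block !mul0mx !addr0 -scalemxAr mul_delta_mx mulmxA.
  by rewrite [_ *m b^T]mx11_scalar -rowE !mxE b2 mul_scalar_mx scale0r.
have := diagonalizable_ker_sqr (lam := real_complex R 2^-1)
  (v := map_mx (real_complex R) v) dg.
rewrite !complexM vA half mul_row_block !mul0mx !mulmx0 !addr0 add0r.
rewrite -scalemxAl mulmxA trmx_delta mul_delta_mx_0 1?eq_sym // mul0mx
  scaler0 row_mx0 map_mx0.
move=> /(_ erefl) /eqP; rewrite map_mx_eq0 -row_mx0 => /eqP /eq_row_mx[_].
move/rowP/(_ i2)/eqP; rewrite !mxE !eqxx mulr1 mulf_eq0 (negPf b1) orbF.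
by rewrite pnatr_eq0.
Qed.

End Shear.

(** * [R^n] as a one-chart manifold carrying the shear connection *)

Section AffineSpace.
Variables (R : realType) (n : nat).

Definition id_chart : chart R n 'rV[R]_n.
Proof.
apply: (@Chart R n 'rV[R]_n setT id id) => //.
- exact: openT.
- by rewrite image_id; exact: openT.
- by move=> p _; exact: cvg_id.
- by move=> p _; exact: cvg_id.
Defined.

Definition affine_space : smooth_manifold R n.
Proof.
apply: (@SmoothManifold R n 'rV[R]_n _ (second_countable_rV R n) unit
  (fun=> id_chart)).
- exact: norm_hausdorff.
- by move=> p; exists tt.
- by move=> a b l; exact: smooth_coord.
Defined.

Variables (i0 i1 i2 : 'I_n).

Lemma dtrans_affine_space (a b : mindex affine_space) i l (x : 'rV[R]_n) :
  dtrans a b i l x = (i == l)%:R.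
Proof. by rewrite /dtrans /trans derive_coord mxE eqxx eq_sym. Qed.

Definition shear_connection : affine_connection affine_space.
Proof.
refine (@AffineConnection R n affine_space (fun=> @shear R n i0 i1 i2) _ _ _).
- by move=> a i j k; exact: smooth_shear.
- move=> a b p i j l _ _ /=.
  (* The change of coordinates is the identity: its second derivatives vanish and both sums collapse
     to a single symbol. *)
  rewrite (_ : dtrans a b j l = cst (j == l)%:R); last first.
    by apply/funext => x; rewrite dtrans_affine_space.
  rewrite derive_cst add0r.
  under eq_bigr do rewrite dtrans_affine_space mulr_natr mulrb.
  rewrite -big_mkcond big_pred1_eq.
  under eq_bigr do under eq_bigr do rewrite !dtrans_affine_space !mulr_natr !mulrb.
  rewrite (bigD1 i) //= [X in _ + X]big1 => [|r /negPf ri]; last first.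
    by apply: big1 => s _; rewrite [i == r]eq_sym ri if_same.
  by rewrite addr0 -big_mkcond eqxx /= (big_pred1 j) // => s; rewrite eq_sym.
- by move=> a p u v _; exact: torsion_shear.
Defined.

Definition zero_covector : cotangent affine_space.
Proof.
apply: (@Cotangent R n affine_space (0 : 'rV[R]_n) (fun=> 0)).
by move=> a b i _ _; rewrite mxE big1 // => l _; rewrite mxE mul0r.
Defined.

Lemma para_complex_jacobi_operator_shear (b : 'rV[R]_n) :
  i0 != i1 -> i0 != i2 -> i1 != i2 -> b 0 i0 = 2^-1 ->
  para_complex_jacobi_operator shear_connection (jacobi_pi i0 i1 i2 b).
Proof.
move=> i01 i02 i12 b0; exists (tt : mindex affine_space), zero_covector.
exists (shear_plane i0 b).
have -> : ccoord (tt : mindex affine_space) zero_covector = 0 by exact: row_mx0.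
by split=> //; [exact: para_complex_plane_shear|exact: is_para_complex_jacobi_shear].
Qed.

End AffineSpace.

Theorem theorem1p5 (R : realType) (n : nat) (hn : (3 <= n)%N) :
  exists (M : smooth_manifold R n) (D : affine_connection M),
    [/\ affine_osserman D,
        ~ jordan_semi_para_complex_osserman D &
        exists A : 'M[R]_(n + n),
          para_complex_jacobi_operator D A /\
          ~ diagonalizable (complexify A)].
Proof.
pose i0 : 'I_n := Ordinal (ltn_trans (isT : 0 < 2)%N hn).
pose i1 : 'I_n := Ordinal (ltn_trans (isT : 1 < 2)%N hn).
pose i2 : 'I_n := Ordinal hn.
have i01 : i0 != i1 by [].
have i02 : i0 != i2 by [].
have i12 : i1 != i2 by [].
(* Here [b_{i0} = 1/2] normalizes the plane, while [b_{i1} = 1] and [b_{i2} = 0] create the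
   nontrivial Jordan block. *)
pose b : 'rV[R]_n := 2^-1 *: delta_mx 0 i0 + delta_mx 0 i1.
have opb := @para_complex_jacobi_operator_shear R n i0 i1 i2 b i01 i02 i12.
have ndiag : ~ diagonalizable (complexify (jacobi_pi i0 i1 i2 b)).
  apply: not_diagonalizable_jacobi_pi => //.
    by rewrite !mxE /= mulr0 add0r oner_eq0.
  by rewrite !mxE /= mulr0 addr0.
have {}opb : para_complex_jacobi_operator (shear_connection R i0 i1 i2)
    (jacobi_pi i0 i1 i2 b).
  by apply: opb; rewrite !mxE /= mulr1 addr0.
exists (affine_space R n), (shear_connection R i0 i1 i2); split.
- by move=> a p X _; exact: nilpotent_jacobi_shear.
(* A common Jordan form would also be that of the diagonal operator for [b = e_{i0}/2], making the
   operator for the present [b] diagonalizable. *)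
- case=> J JP; apply: ndiag.
  have op0 := @para_complex_jacobi_operator_shear R n i0 i1 i2
    (2^-1 *: delta_mx 0 i0) i01 i02 i12.
  have [|_ sim0] := JP _ (op0 _); first by rewrite !mxE /= mulr1.
  have [_ simb] := JP _ opb.
  by apply: similar_diag_diagonalizable sim0 simb; exact: is_diag_jacobi_pi.
- by exists (jacobi_pi i0 i1 i2 b).
Qed.
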